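(* Let $\beta$ be a complex number such that $|\beta|>1$ and let $\mathcal{A}\subset\mathbb{Z}[\beta]$ be a finite alphabet with $0\in\mathcal{A}$. (a) If $1\in\operatorname{Fin}_{\mathcal{A}}(\beta)$ and the set $\operatorname{Fin}_{\mathcal{A}}(\beta)$ is closed under addition, then $\beta$ is an algebraic number. (b) If $1\in\mathcal{A}[\beta]$ and the set $\mathcal{A}[\beta]$ is closed under addition, then $\beta$ is an algebraic number.
   Context: $\mathbb{N}$ contains $0$. $\mathbb{Z}[\beta]$ is the smallest ring containing $\mathbb{Z}$ and $\beta$. Define $\operatorname{Fin}_{\mathcal{A}}(\beta)=\{\sum_{j=-m}^n x_j\beta^j : n,m\in\mathbb{N},\ x_j\in\mathcal{A}\}$ and $\mathcal{A}[\beta]=\{\sum_{j=0}^n x_j\beta^j : n\in\mathbb{N},\ x_j\in\mathcal{A}\}$. *)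

(* Defs.v *)
From HB Require Import structures.
From mathcomp Require Import all_boot all_order all_algebra complex.
From mathcomp Require Import boolp classical_sets cardinality reals.
Set Implicit Arguments.
Unset Strict Implicit.
Unset Printing Implicit Defensive.
Import Order.TTheory GRing.Theory Num.Theory.
Local Open Scope classical_set_scope.
Local Open Scope ring_scope.

Definition is_subring (K : pzRingType) (S : set K) : Prop :=
  subring_closed [in S].

(* Z[b] *)
Definition Zadjoin (K : pzRingType) (b : K) : set K :=
  smallest (@is_subring K) (range (fun n : int => n%:~R) `|` [set b]).

(* Fin_A(b). The index k of the sum stands for the exponent j = k - m, which runs through
   the integer interval -m, ..., n; the digits x j are indexed by that
   exponent. *)
Definition Fin (K : unitRingType) (A : set K) (b : K) : set K :=
  [set z | exists (n m : nat) (x : int -> K),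
     (forall j : int, - m%:Z <= j <= n%:Z -> A (x j)) /\
     z = \sum_(0 <= k < (m + n).+1) x (k%:Z - m%:Z) * b ^ (k%:Z - m%:Z)].

(* A[b] *)
Definition digit_polys (K : pzRingType) (A : set K) (b : K) : set K :=
  [set z | exists (n : nat) (x : nat -> K),
     (forall j : nat, (j <= n)%N -> A (x j)) /\
     z = \sum_(0 <= j < n.+1) x j * b ^+ j].

Definition closed_under_addition (K : nmodType) (S : set K) : Prop :=
  forall u v : K, S u -> S v -> S (u + v).

Definition algebraic_number (K : numFieldType) (z : K) : Prop :=
  algebraicOver (ratr : rat -> K) z.

(* Main.v *)
Require Import Defs.
From HB Require Import structures.
From mathcomp Require Import all_boot all_order all_algebra complex.
From mathcomp Require Import boolp classical_sets cardinality reals.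
Set Implicit Arguments.
Unset Strict Implicit.
Unset Printing Implicit Defensive.
Import Order.TTheory GRing.Theory Num.Theory.
Local Open Scope classical_set_scope.
Local Open Scope ring_scope.

(** If [beta] were transcendental, evaluation at [beta] would identify Z[X] with
    Z[beta], so every digit [a] would come from a single integer polynomial
    [P a].  Closure under addition puts every positive integer [N] in the set
    of representable numbers.  After multiplication by a power of [beta], a
    representation of [N] becomes an identity of polynomials

      N X^m = \sum_k P(x_k) X^k,

    whose coefficient of X^m reads N = \sum_(k <= m) (P (x_k))_(m - k).  In this
    sum each index i = m - k occurs at most once, so it is bounded by the sum,
    over the finitely many digits [a], of the absolute values of all the
    coefficients of [P a].  This bound does not depend on [N], although [N] is
    arbitrary: a contradiction ([algebraic_of_expansions]).  The same argument
    serves both parts, with m = 0 when no negative exponents occur; negative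
    powers of [beta] can be cleared because |beta| > 1 makes [beta] nonzero. *)

Definition coef_norm1 (p : {poly int}) : int := \sum_(i < size p) `|p`_i|.

Lemma sum_coef_le_norm1 (p : {poly int}) (n : nat) :
  \sum_(i < n) `|p`_i| <= coef_norm1 p.
Proof.
case: (leqP n (size p)) => [le_n | lt_n].
  rewrite (big_ord_widen _ (fun i => `|p`_i|) le_n).
  rewrite [leRHS](bigID (fun i : 'I__ => i < n)%N).
  by rewrite lerDl sumr_ge0.
rewrite /coef_norm1 (big_ord_widen _ (fun i => `|p`_i|) (ltnW lt_n)).
rewrite [leLHS](bigID (fun i : 'I__ => i < size p)%N) /= gerDl big1 // => i.
by rewrite -leqNgt => le_i; rewrite nth_default ?normr0.
Qed.

Lemma Zadjoin_horner (K : comNzRingType) (b : K) :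
  Zadjoin b `<=` [set z | exists p : {poly int}, z = (map_poly intr p).[b]].
Proof.
move=> z; apply; split.
- split=> /=.
  + by rewrite inE; exists 1; rewrite rmorph1 hornerC.
  + move=> u v; rewrite !inE => -[p ->] [q ->].
    by exists (p - q); rewrite rmorphB hornerD hornerN.
  + move=> u v; rewrite !inE => -[p ->] [q ->].
    by exists (p * q); rewrite rmorphM hornerM.
- move=> _ [[n _ <-] | ->].
  + by exists n%:P; rewrite map_polyC hornerC.
  + by exists 'X; rewrite map_polyX hornerX.
Qed.

Lemma algebraic_of_int_root (K : numFieldType) (b : K) (p : {poly int}) :
  p != 0 -> (map_poly intr p).[b] = 0 -> algebraic_number b.
Proof.
move=> p_neq0 pb0; exists (map_poly intr p).
  by rewrite map_poly_eq0_id0 // intr_eq0 lead_coef_eq0.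
rewrite -map_poly_comp (eq_map_poly (g := intr)) ?rootE ?pb0 //.
by move=> n /=; rewrite ratr_int.
Qed.

(** The coefficient bound of the argument.  Comparing coefficients of X^m only
    involves the i-th coefficient of the digit in position m - i, so replacing
    that digit by the sum over all digits costs nothing that depends on the
    length of the expansion. *)
Lemma natural_le_digit_norms (K : eqType) (s : seq K) (P : K -> {poly int})
    (N m n : nat) (x : nat -> K) :
  (forall k, (k < n)%N -> x k \in s) ->
  N%:R *: 'X^m = \sum_(k < n) P (x k) * 'X^k ->
  N%:R <= \sum_(a <- s) coef_norm1 (P a).
Proof.
move=> xs /(congr1 (fun p : {poly int} => p`_m)).
rewrite coefZ coefXn eqxx mulr1 coef_sum => ->.
apply: (@le_trans _ _ (\sum_(i < m.+1) \sum_(a <- s) `|(P a)`_i|)); last first.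
  by rewrite exchange_big; apply: ler_sum => a _; apply: sum_coef_le_norm1.
pose c k := `|(P (x k))`_(m - k)|.
apply: (@le_trans _ _ (\sum_(k < n | (k < m.+1)%N) c k)).
  rewrite [leRHS]big_mkcond; apply: ler_sum => k _.
  by rewrite coefMXn ltnS; case: (ltnP m k) => //= _; apply: ler_norm.
(* the range k < n and the filter k <= m trade places inside k < max(n, m + 1) *)
rewrite (big_ord_widen_cond _ (fun k => k < m.+1)%N c (leq_maxl n m.+1)).
under eq_bigl => k do rewrite andbC.
rewrite -(big_ord_widen_cond _ (fun k => k < n)%N c (leq_maxr n m.+1)).
rewrite big_mkcond (reindex_inj rev_ord_inj) /=; apply: ler_sum => i _.
rewrite /c subSS subKn ?leq_ord //; case: ifP => [lt_n | _]; last exact: sumr_ge0.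
by rewrite (big_rem _ (xs _ lt_n)) /= lerDl sumr_ge0.
Qed.

(** Stating the expansions up to a factor b^m covers Fin and A[b] at once.  All
    that is needed of closure under addition is that the positive integers lie
    in [S]; one integer above the coefficient bound is then contradictory. *)
Lemma algebraic_of_expansions (K : numFieldType) (b : K) (A S : set K) :
  A `<=` Zadjoin b -> finite_set A ->
  (forall z, S z -> exists (m n : nat) (x : nat -> K),
     (forall k, (k < n)%N -> A (x k)) /\
     z * b ^+ m = \sum_(k < n) x k * b ^+ k) ->
  S 1 -> closed_under_addition S -> algebraic_number b.
Proof.
move=> AZ /finite_seqP[s As] expS S1 S_add.
apply: contrapT => b_tr.
have [|P PE] := @choice K {poly int}
    (fun a p => A a -> a = (map_poly intr p).[b]).
  move=> a.
  have [/AZ /Zadjoin_horner[p ap] | nAa] := pselect (A a); last by exists 0.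
  by exists p.
have S_nat N : S N.+1%:R.
  by elim: N => // N SN; rewrite -addn1 natrD; apply: S_add.
pose B := \sum_(a <- s) coef_norm1 (P a).
suff : `|B|%N.+1%:R <= B.
  by rewrite leNgt (le_lt_trans (ler_norm B)) // -abszE natz ltz_nat.
have [m [n [x [Ax eq_x]]]] := expS _ (S_nat `|B|%N).
apply: (natural_le_digit_norms (m := m) (n := n) (x := x)).
  by move=> k /Ax; rewrite As.
(* transcendence of b turns the equality of values into one of polynomials *)
apply/eqP; rewrite -subr_eq0; apply/negPn/negP => q_neq0.
apply: b_tr; apply: (algebraic_of_int_root q_neq0).
rewrite rmorphB hornerD hornerN rmorph_sum horner_sum /= map_polyZ map_polyXn.
rewrite hornerZ hornerXn rmorph_nat eq_x; apply/eqP; rewrite subr_eq0; apply/eqP.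
apply: eq_bigr => k _.
by rewrite rmorphM hornerM /= map_polyXn hornerXn -PE //; apply: Ax.
Qed.

Theorem corollary2p3 (R : realType) (beta : complex R) (A : set (complex R))
    (hbeta : 1 < `|beta|) (hA : A `<=` Zadjoin beta) (hfin : finite_set A)
    (h0 : A 0) :
  (Fin A beta 1 -> closed_under_addition (Fin A beta) ->
     algebraic_number beta) /\
  (digit_polys A beta 1 -> closed_under_addition (digit_polys A beta) ->
     algebraic_number beta).
Proof.
have beta_neq0 : beta != 0 by rewrite -normr_gt0 (lt_trans ltr01 hbeta).
split; apply: (algebraic_of_expansions hA hfin) => z.
- move=> [n [m [x [Ax ->]]]].
  exists m, (m + n).+1, (fun k => x (k%:Z - m%:Z)); split=> [k lt_k|].
    apply: Ax; rewrite lerBrDr addNr le0z_nat lerBlDr -PoszD lez_nat.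
    by rewrite addnC -ltnS.
  rewrite big_mkord mulr_suml; apply: eq_bigr => k _.
  by rewrite -mulrA !exprnP -expfzDr // subrK.
- move=> [n [x [Ax ->]]].
  by exists 0%N, n.+1, x; split=> [k /Ax //|]; rewrite mulr1 big_mkord.
Qed.
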